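(* Let $\alpha>1$ and let $G$ be a random graph on $n$ vertices generated by the erased configuration model with a power law degree sequence with exponent $\alpha$. Then, for $n$ sufficiently large, $G$ is a PLB graph with parameters $\alpha$ and $t=0$. Moreover, when $\alpha>2$, with high probability $G$ has PLB neighborhoods. (These statements hold for suitable universal constants $c_1$ and $c_2$ in the definitions below.)
   Context: All graphs are finite and simple; $n$ is the number of vertices and $\log$ is the binary logarithm. Erased configuration model: first fix deterministically a degree for every vertex so that, for every $k\ge 1$, the number of vertices of degree $k$ is $\Theta(n/k^{\alpha})$ (constants depending only on $\alpha$); if the degree sum is odd, one extra vertex of degree $1$ is added. Build a complete graph $H$ containing $\deg(v)$ copies of each vertex $v$, choose a uniformly random perfect matching of $H$ and keep only its edges, then merge all copies of each vertex into one vertex; finally delete self-loops and multiple edges. PLB graph: for a universal constant $c_1>0$, an $n$-vertex graph is power law bounded (PLB) with parameters $\alpha>1$ (a constant) and real $t\ge 0$ if for every integer $d\ge 0$ the number of vertices $v$ with $\deg(v)\in[2^d,2^{d+1})$ is at most $c_1 n (t+1)^{\alpha-1}\sum_{i=2^d}^{2^{d+1}-1}(i+t)^{-\alpha}$. PLB neighborhoods: for a universal constant $c_2>0$, a PLB graph with parameters $\alpha>2$ and $t$ has PLB neighborhoods if for every vertex $v$ of degree $k$, the number of neighbors of $v$ of degree at least $k$ is at most $c_2\max\big(\log n,\ (t+1)^{\alpha-2}k\sum_{i=k}^{n-1} i(i+t)^{-\alpha}\big)$. ''With high probability'' means with probability at least $1-n^{-c}$ for a constant $c>0$.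
   Formalization: The constants c_1, c_2 may depend on α and on the Θ-constants (not on n or the degree sequence), since constants independent of α cannot exist; the lower bound in Θ(n/k^α) is rounded down to an integer, since it cannot hold literally for every k. *)

(* Defs.v *)
From HB Require Import structures.
From mathcomp Require Import all_boot all_order all_algebra.
From mathcomp Require Import boolp reals exp.

Set Implicit Arguments.
Unset Strict Implicit.
Unset Printing Implicit Defensive.

Import Order.TTheory GRing.Theory Num.Theory.
Local Open Scope ring_scope.

Record sgraph (V : finType) := SGraph {
  adj :> rel V;
  adj_sym : symmetric adj;
  adj_irr : irreflexive adj }.

Definition gdeg (V : finType) (G : sgraph V) (v : V) : nat :=
  #|[set w | G v w]|.

Definition log2 (R : realType) (x : R) : R := ln x / ln 2.

Definition PLB (R : realType) (c1 alpha t : R) (V : finType) (G : sgraph V)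
    : Prop :=
  forall d : nat,
    #|[set v | (2 ^ d <= gdeg G v < 2 ^ d.+1)%N]|%:R <=
    c1 * #|V|%:R * (t + 1) `^ (alpha - 1) *
      \sum_(2 ^ d <= i < 2 ^ d.+1) (i%:R + t) `^ (- alpha).

(* When [k = 0] and [t = 0] the summand at [i = 0] is [0 * 0 `^ (- alpha) = 0]. *)
Definition PLB_neighborhoods (R : realType) (c1 c2 alpha t : R)
    (V : finType) (G : sgraph V) : Prop :=
  PLB c1 alpha t G /\
  forall v : V, let k := gdeg G v in
    #|[set w | G v w && (k <= gdeg G w)%N]|%:R <=
    c2 * Num.max (log2 (#|V|%:R : R))
      ((t + 1) `^ (alpha - 2) * k%:R *
        \sum_(k <= i < #|V|) i%:R * (i%:R + t) `^ (- alpha)).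

(* The counts are integers, so the lower half of "the number of vertices of
   degree k is Theta(n / k ^ alpha) for every k >= 1" is understood up to
   rounding down: without it no finite sequence would qualify, since
   n / k ^ alpha is positive but tends to 0 as k grows. *)
Definition power_law_degrees (R : realType) (a b alpha : R) (n : nat)
    (deg : 'I_n -> nat) : Prop :=
  forall k : nat, (0 < k)%N ->
    let N := #|[set v | deg v == k]| in
    let x := n%:R / k%:R `^ alpha in
    (Num.truncn (a * x) <= N)%N /\ N%:R <= b * x.

(* The number of vertices after adding, when the degree sum is odd, one vertex
   of degree 1. *)
Definition nvert (n : nat) (deg : 'I_n -> nat) : nat :=
  (n + odd (\sum_(i < n) deg i))%N.

Definition even_deg (n : nat) (deg : 'I_n -> nat) (v : 'I_(nvert deg)) : nat :=
  match split v with inl i => deg i | inr _ => 1%N end.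

Definition complete_adj (T : finType) : rel T := fun x y => x != y.

Lemma complete_sym (T : finType) : symmetric (@complete_adj T).
Proof. by move=> x y; rewrite /complete_adj eq_sym. Qed.

Lemma complete_irr (T : finType) : irreflexive (@complete_adj T).
Proof. by move=> x; rewrite /complete_adj eqxx. Qed.

Definition complete_graph (T : finType) : sgraph T :=
  SGraph (@complete_sym T) (@complete_irr T).

Definition perfect_matching (T : finType) (H : sgraph T) (M : {set {set T}})
    : bool :=
  partition M [set: T] &&
  [forall e in M, [exists x, exists y, H x y && (e == [set x; y])]].

(* [Tagged _ i] with [i : 'I_(deg v)] is the [i]-th copy of the vertex [v]. *)
Definition copies (V : finType) (deg : V -> nat) : finType :=
  {v : V & 'I_(deg v)}.

(* Merging the copies of each vertex: excluding [u = v] deletes the self-loops,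
   and using a relation identifies parallel edges. *)
Definition merge_adj (V : finType) (deg : V -> nat)
    (M : {set {set copies deg}}) : rel V :=
  fun u v => (u != v) &&
    [exists x : copies deg, exists y : copies deg,
      [&& tag x == u, tag y == v & [set x; y] \in M]].

Lemma merge_sym (V : finType) (deg : V -> nat) (M : {set {set copies deg}}) :
  symmetric (merge_adj M).
Proof.
suff sub u v : merge_adj M u v -> merge_adj M v u.
  by move=> u v; apply/idP/idP; exact: sub.
case/andP=> uv /existsP[x /existsP[y /and3P[xu yv xyM]]].
rewrite /merge_adj eq_sym uv; apply/existsP; exists y; apply/existsP; exists x.
by rewrite xu yv setUC.
Qed.

Lemma merge_irr (V : finType) (deg : V -> nat) (M : {set {set copies deg}}) :
  irreflexive (merge_adj M).
Proof. by move=> u; rewrite /merge_adj eqxx. Qed.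

Definition erased_graph (V : finType) (deg : V -> nat)
    (M : {set {set copies deg}}) : sgraph V :=
  SGraph (merge_sym M) (merge_irr M).

Definition matchings (n : nat) (deg : 'I_n -> nat)
    : {set {set {set copies (@even_deg n deg)}}} :=
  [set M | perfect_matching (complete_graph (copies (@even_deg n deg))) M].

Definition erased_prob (R : realType) (n : nat) (deg : 'I_n -> nat)
    (P : sgraph 'I_(nvert deg) -> Prop) : R :=
  #|[set M in matchings deg | `[< P (erased_graph M) >]]|%:R /
  #|matchings deg|%:R.

(* Main.v *)
Require Import Defs.
From HB Require Import structures.
From mathcomp Require Import all_boot all_order all_algebra.
From mathcomp Require Import perm.
From mathcomp Require Import boolp reals exp.
From mathcomp Require Import zify ring lra.

Set Implicit Arguments.
Unset Strict Implicit.
Unset Printing Implicit Defensive.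

Import Order.TTheory GRing.Theory Num.Theory.

(** Erasing loops and multiple edges only lowers degrees, so PLB follows, for
    every matching, from the tail bound [sum_(i >= k) i ^ - g = O(k ^ (1 - g))].

    For the neighborhoods, let [S] be a set of [s] copies and [Y] a set of
    copies.  A switching argument bounds the proportion of the matchings that
    send [S] into [Y :\: S] by [(#|Y| / (L - 2 s)) ^ s], with [L] the number of
    copies.  Let [v] have degree [D] before and [k] after erasure.
    - If [k] is much smaller than [D], about half of the copies of [v] are sent
      to the copies of few vertices; as degrees are [O(n ^ (1 / alpha))] and
      [alpha > 2], a union bound over these copies and vertices makes this
      polynomially unlikely as soon as [D] exceeds a constant.
    - Otherwise [D <= q k] for a constant [q], and [m] neighbors of degree at
      least [k] give [m] copies of [v] sent to vertices of degree at least
      [D / q], which carry [O(n D ^ (2 - alpha))] copies.  A union bound over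
      the sets of [m] copies of [v] leaves probability at most [2 ^ - m] once
      [m] exceeds a constant times [D ^ (3 - alpha)]. *)

(** * Counting perfect matchings *)

Section Matchings.
Variable T : finType.
Implicit Types (M : {set {set T}}) (f : T -> T) (S Y : {set T}).

Definition perfect_matchings : {set {set {set T}}} :=
  [set M | perfect_matching (complete_graph T) M].

(** Switchings are easier on functions than on sets of edges: a perfect matching amounts to the
    fixed-point-free involution [partner M], and [matching_of] translates back. *)
Definition partner M (x : T) : T :=
  odflt x [pick y | (y != x) && ([set x; y] \in M)].

Definition matching_of f : {set {set T}} := [set [set x; f x] | x : T].

Lemma partnerP M x y : M \in perfect_matchings ->
  ([set x; y] \in M) = (y == partner M x).
Proof.
rewrite inE => /andP[/and3P[/eqP cov /trivIsetP triv _]] /forall_inP edges.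
have neq u w : [set u; w] \in M -> w != u.
  move=> uwM; have /existsP[a /existsP[c /andP[ac /eqP e]]] := edges _ uwM.
  apply/eqP => wu; move: (cards2 a c) ac; rewrite -e wu setUid cards1.
  by rewrite /= /complete_adj; case: (a != c).
have uni u w z : [set u; w] \in M -> [set u; z] \in M -> w = z.
  move=> uw uz; have [e|/(triv _ _ uw uz)] := eqVneq [set u; w] [set u; z].
    have : w \in [set u; z] by rewrite -e !inE eqxx orbT.
    by rewrite !inE (negPf (neq _ _ uw)) => /eqP.
  by move/pred0P/(_ u); rewrite /= !inE eqxx.
suff xM : [set x; partner M x] \in M.
  by apply/idP/eqP => [xy|->//]; exact: uni xy xM.
rewrite /partner; case: pickP => [z /andP[]//|no].
have : x \in cover M by rewrite cov inE.
case/bigcupP=> e eM; have /existsP[u /existsP[w /andP[_ /eqP ee]]] := edges _ eM.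
rewrite ee !inE => /orP[] /eqP xe.
  by move: (no w); rewrite xe -ee eM andbT neq // -ee.
by move: (no u); rewrite xe setUC -ee eM andbT neq // setUC -ee.
Qed.

Lemma partner_neq M x : M \in perfect_matchings -> partner M x != x.
Proof.
move=> Mp; have xM : [set x; partner M x] \in M by rewrite partnerP.
move: Mp; rewrite inE => /andP[_ /forall_inP edges].
have /existsP[a /existsP[c /andP[ac /eqP e]]] := edges _ xM.
apply/eqP => wu; move: (cards2 a c) ac; rewrite -e wu setUid cards1.
by rewrite /= /complete_adj; case: (a != c).
Qed.

Lemma partnerK M : M \in perfect_matchings -> involutive (partner M).
Proof. by move=> Mp x; apply/esym/eqP; rewrite -partnerP // setUC partnerP. Qed.

Lemma matching_ofP f : involutive f -> (forall x, f x != x) ->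
  matching_of f \in perfect_matchings.
Proof.
move=> fK fx; rewrite inE; apply/andP; split; last first.
  apply/forall_inP => _ /imsetP[x _ ->]; apply/existsP; exists x.
  by apply/existsP; exists (f x); rewrite /= /complete_adj eq_sym fx eqxx.
apply/and3P; split.
- rewrite eqEsubset subsetT; apply/subsetP => x _; apply/bigcupP.
  by exists [set x; f x]; [exact: imset_f | rewrite !inE eqxx].
- apply/trivIsetP => _ _ /imsetP[x _ ->] /imsetP[y _ ->] neq.
  apply/pred0P => z /=; apply/negP; rewrite !inE => /andP[zx zy].
  case/negP: neq; apply/eqP.
  by case/orP: zx zy => /eqP -> /orP[] /eqP; rewrite ?(inj_eq (inv_inj fK)) //;
     [move=> -> | move=> -> | move=> <- | move/(inv_inj fK) -> ];
     rewrite ?fK // setUC.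
- apply/imsetP => -[x _ /setP/(_ x)]; by rewrite !inE eqxx.
Qed.

Lemma partner_matching_of f : involutive f -> (forall x, f x != x) ->
  partner (matching_of f) =1 f.
Proof.
move=> fK fx x; apply/esym/eqP; rewrite -partnerP ?matching_ofP //.
exact: imset_f.
Qed.

Lemma partner_inj M M' : M \in perfect_matchings -> M' \in perfect_matchings ->
  partner M =1 partner M' -> M = M'.
Proof.
have sub M1 M2 : M1 \in perfect_matchings -> M2 \in perfect_matchings ->
    partner M1 =1 partner M2 -> M1 \subset M2.
  move=> p1 p2 e; apply/subsetP => e1 e1M.
  move: (p1); rewrite inE => /andP[_ /forall_inP/(_ _ e1M)].
  case/existsP=> x /existsP[y /andP[_ /eqP ee]].
  by rewrite ee in e1M *; move: e1M; rewrite !partnerP // e.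
move=> p p' e; apply/eqP; rewrite eqEsubset !sub // => x; exact/esym/e.
Qed.

Lemma perfect_matchings_gt0 : ~~ odd #|T| -> (0 < #|perfect_matchings|)%N.
Proof.
move=> ev; rewrite card_gt0; apply/set0Pn.
(* [g] swaps [2 i] and [2 i + 1]; it stays below [#|T|] because that number is even. *)
pose g (i : nat) := (if odd i then i.-1 else i.+1)%N.
have gK i : g (g i) = i.
  rewrite /g; case: (boolP (odd i)) => oi /=; last by rewrite oi.
  by case: i oi => //= i; case: (odd i).
have gN i : g i <> i by rewrite /g; case: (boolP (odd i)) => oi; lia.
have glt (i : 'I_#|T|) : (g i < #|T|)%N.
  have := ltn_ord i; rewrite /g; case: (boolP (odd i)) => oi; lia.
pose f x := enum_val (Ordinal (glt (enum_rank x))).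
exists (matching_of f); apply: matching_ofP => x.
  rewrite /f; apply: (canLR (@enum_rankK T)); apply: val_inj => /=.
  by rewrite enum_valK /= gK.
apply/eqP => /(congr1 (@enum_rank T)); rewrite /f enum_valK.
by move/(congr1 val) => /=; exact: gN.
Qed.

(** Partners outside [S] make the [#|S|] edges at [S] distinct, so that each contributes its own
    factor in [card_hits]. *)
Definition hits S Y M : bool := [forall x in S, partner M x \in Y :\: S].

(* Switching: from a matching pairing [x] with [y] in [Y], and [z] outside
   [x |: S] and its partners, exchange [y] and [z].  The new matching still
   sends [S] into [Y :\: S], and together with [y] it determines the old one. *)
Lemma hits_setU1 S Y x : x \notin S ->
  (#|[set M in perfect_matchings | hits (x |: S) Y M]| * (#|T| - 2 * #|S|.+1) <=
   #|Y| * #|[set M in perfect_matchings | hits S Y M]|)%N.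
Proof.
move=> xS; set A := [set M in _ | _]; set B := [set M in _ | _].
pose far M := ~: ((x |: S) :|: partner M @: (x |: S)).
pose P := [set p : {set {set T}} * T | (p.1 \in A) && (p.2 \in far p.1)].
apply: (@leq_trans #|P|).
  have -> : #|P| = (\sum_(M in A) #|far M|)%N.
    rewrite -sum1dep_card; under [RHS]eq_bigr do rewrite -sum1_card.
    by rewrite pair_big_dep.
  rewrite -sum_nat_const; apply: leq_sum => M _.
  rewrite /far [#|~: _|]cardsCs setCK leq_sub2l // mulSn mul1n.
  have cU : #|x |: S| = #|S|.+1 by rewrite cardsU1 xS.
  apply: leq_trans (leq_card_setU _ _).1 _.
  by rewrite cU leq_add2l -cU leq_imset_card.
(* Conjugating [partner M] by a transposition gives again an involution without fixed points. *)
pose h M y z u := tperm y z (partner M (tperm y z u)).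
have hK M y z : M \in perfect_matchings -> involutive (h M y z).
  by move=> Mp u; rewrite /h tpermK partnerK // tpermK.
have hN M y z u : M \in perfect_matchings -> h M y z u != u.
  move=> Mp; rewrite /h; apply/eqP => /(congr1 (tperm y z)); rewrite tpermK.
  by apply/eqP; exact: partner_neq.
pose phi (p : {set {set T}} * T) :=
  (partner p.1 x, matching_of (h p.1 (partner p.1 x) p.2)).
have PP M z : (M, z) \in P -> [/\ M \in perfect_matchings,
    forall u, u \in x |: S -> partner M u \in Y :\: (x |: S),
    z \notin x |: S & forall u, u \in x |: S -> z != partner M u].
  rewrite inE /= inE => /andP[/andP[Mp /forall_inP hM]].
  rewrite inE in_setU => /norP[zS zf]; split=> // u uS.
  by apply: contraNneq zf => ->; rewrite imset_f.
(* [z] is the new partner of [x], so the image under [phi] determines it; undoing the transposition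
   then recovers [M]. *)
have phix M z : (M, z) \in P -> h M (partner M x) z x = z.
  case/PP=> Mp hM zS zf; rewrite /h [tperm _ _ x]tpermD ?partner_neq //.
    by rewrite tpermL.
  by apply: contraNneq zS => ->; rewrite !inE eqxx.
rewrite -cardsX -(@card_in_imset _ _ phi P); last first.
  move=> [M z] [M' z'] MP MP' /= [e1 e2].
  have [Mp _ _ _] := PP _ _ MP; have [Mp' _ _ _] := PP _ _ MP'.
  have e : h M (partner M x) z =1 h M' (partner M' x) z'.
    move=> u; rewrite -(partner_matching_of (hK _ _ _ Mp)) ?hN // => [|w].
      by rewrite e2 partner_matching_of // => [|w]; [exact: hK|rewrite hN].
    by rewrite hN.
  have ez : z = z' by rewrite -(phix _ _ MP) -(phix _ _ MP') e.
  congr pair => //; apply: partner_inj => // u.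
  have := e (tperm (partner M x) z u).
  by rewrite /h -e1 ez tpermK => /perm_inj.
apply/subset_leq_card/subsetP => _ /imsetP[[M z] MP ->].
have [Mp hM zS zf] := PP _ _ MP.
have xU : x \in x |: S by rewrite !inE eqxx.
have SU u : u \in S -> u \in x |: S by rewrite !inE => ->; rewrite orbT.
rewrite in_setX inE /=; apply/andP; split.
  by have := hM _ xU; rewrite inE => /andP[].
have fK := hK _ (partner M x) z Mp.
have fN u : h M (partner M x) z u != u by exact: hN.
rewrite matching_ofP //=.
apply/forall_inP => u uS.
rewrite partner_matching_of //.
have ne w : w \in S -> partner M x != w.
  move=> wS; have := hM _ xU; rewrite inE => /andP[+ _].
  by apply: contraNneq => ->; exact: SU.
rewrite /h [tperm _ _ u]tpermD ?ne //; last first.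
  by apply: contraNneq zS => ->; exact: SU.
rewrite tpermD ?zf ?SU //.
  by have := hM _ (SU _ uS); rewrite !inE negb_or => /andP[/andP[_ ->] ->].
by rewrite (inj_eq (inv_inj (partnerK Mp))); apply: contraNneq xS => ->.
Qed.

(** The points of [S] are added one at a time by [hits_setU1]. The [i]-th one costs a factor
    [#|Y| / (#|T| - 2 i)], and the worst denominator, at [i = #|S|], serves for all. *)
Lemma card_hits S Y :
  (#|[set M in perfect_matchings | hits S Y M]| * (#|T| - 2 * #|S|) ^ #|S| <=
   #|Y| ^ #|S| * #|perfect_matchings|)%N.
Proof.
have [s] := ubnP #|S|; elim: s S => // s IH S; rewrite ltnS => Ss.
have [->|[x xS]] := set_0Vmem S.
  rewrite cards0 !expn0 muln1 mul1n; apply/subset_leq_card/subsetP => M.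
  by rewrite inE => /andP[].
have x' : x \notin S :\ x by rewrite !inE eqxx.
have := hits_setU1 Y x'; rewrite setD1K // => step.
have cS : #|S| = #|S :\ x|.+1 by rewrite (cardsD1 x) xS.
have := IH (S :\ x); rewrite -cS => /(_ Ss) {}IH.
rewrite -cS in step; rewrite {2 3}cS !expnS mulnA.
apply: leq_trans (leq_mul step (leqnn _)) _.
rewrite -!mulnA leq_mul2l; apply/orP; right.
apply: leq_trans IH; rewrite leq_mul2l; apply/orP; right.
have [->//|s0] := posnP #|S :\ x|.
by rewrite leq_exp2r // cS; lia.
Qed.

End Matchings.

(** * Union bounds over sets of matched points *)

Lemma card_exists_le (T I : finType) (P : {set T}) (Q : pred I)
    (E : I -> pred T) :
  (#|[set x in P | [exists i, Q i && E i x]]| <=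
   \sum_(i | Q i) #|[set x in P | E i x]|)%N.
Proof.
rewrite -sum1dep_card.
under [X in (_ <= X)%N]eq_bigr do rewrite -sum1dep_card.
rewrite (exchange_big_dep [in P]) /=; last by move=> i x _ /andP[].
rewrite [X in (X <= _)%N]big_mkcondr /=; apply: leq_sum => x xP.
case: ifP => // /existsP[i /andP[Qi Eix]].
by rewrite (bigD1 i) // Qi xP Eix.
Qed.

Lemma ex_subset_card (T : finType) (A : {set T}) m : (m <= #|A|)%N ->
  exists2 B : {set T}, B \subset A & #|B| = m.
Proof.
case/card_geqP => s [us <- sA]; exists [set x in s].
  by apply/subsetP => x; rewrite inE; exact: sA.
by rewrite cardsE; exact/card_uniqP.
Qed.

Section Crowded.
Variable T : finType.
Implicit Types (M : {set {set T}}) (X Y S : {set T}).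

Definition crowded X s Y M :=
  [exists S : {set T}, ((S \subset X) && (#|S| == s)) && hits S Y M].

(** Union bound over the sets [S], with [card_hits] for each. As [s <= #|X| <= #|T| / 4], the
    denominator [#|T| - 2 s] is at least [#|T| / 2], whence the factor [2 ^ s]. *)
Lemma card_crowded X s Y : (4 * #|X| <= #|T|)%N ->
  (#|[set M in perfect_matchings T | crowded X s Y M]| * #|T| ^ s <=
   'C(#|X|, s) * ((2 * #|Y|) ^ s * #|perfect_matchings T|))%N.
Proof.
move=> XT; have [sX|Xs] := leqP s #|X|; last first.
  rewrite (_ : [set _ in _ | _] = set0) ?cards0 //; apply/setP => M.
  rewrite !inE; apply/negP => /andP[_ /existsP[S /andP[/andP[SX /eqP cS] _]]].
  by move: (subset_leq_card SX); rewrite cS leqNgt Xs.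
have hT : (#|T| <= 2 * (#|T| - 2 * s))%N by lia.
apply: leq_trans (leq_mul (card_exists_le _ _ _) (leqnn _)) _.
rewrite big_distrl /= -cards_draws -sum_nat_const.
rewrite [X in (X <= _)%N](eq_bigl
  [in [set S : {set T} | S \subset X & #|S| == s]]); last first.
  by move=> S; rewrite inE.
apply: leq_sum => S; rewrite inE => /andP[_ /eqP cS].
have := card_hits S Y; rewrite cS => h.
apply: (@leq_trans (2 ^ s * (#|[set M in perfect_matchings T | hits S Y M]| *
   (#|T| - 2 * s) ^ s))).
  rewrite mulnCA leq_mul2l -expnMn; apply/orP; right.
  by case: (posnP s) => [->//|s0]; rewrite leq_exp2r.
by rewrite expnMn -mulnA leq_mul2l h orbT.
Qed.

Lemma crowdedS X s Y Y' M : Y \subset Y' -> crowded X s Y M -> crowded X s Y' M.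
Proof.
move=> YY /existsP[S /andP[h /forall_inP hS]]; apply/existsP; exists S.
rewrite h; apply/forall_inP => x /hS; rewrite !inE => /andP[-> /=].
exact: (subsetP YY).
Qed.

End Crowded.

(** * Copies of vertices and the erased graph *)

Section Copies.
Variables (V : finType) (deg : V -> nat).
Implicit Types (M : {set {set copies deg}}) (v w : V) (W : {set V}).

Definition copies_of W : {set copies deg} := [set x | tag x \in W].

Lemma card_copies_of W : #|copies_of W| = (\sum_(v in W) deg v)%N.
Proof.
transitivity (\sum_(v in W) \sum_(i < deg v) 1)%N.
  by rewrite sig_big_dep -sum1dep_card; apply: eq_bigl => x; rewrite andbT.
by apply: eq_bigr => v _; rewrite sum1_card card_ord.
Qed.

Lemma card_copies : #|copies deg| = (\sum_v deg v)%N.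
Proof.
have <- : #|copies_of setT| = #|copies deg|.
  by apply: eq_card => x; rewrite !inE.
by rewrite card_copies_of; apply: eq_bigl => v; rewrite inE.
Qed.

Lemma erased_adjP M v w : M \in perfect_matchings (copies deg) ->
  reflect (v != w /\ exists2 x, tag x = v & tag (partner M x) = w)
    (erased_graph M v w).
Proof.
move=> Mp; apply: (iffP andP) => [[vw /existsP[x /existsP[y]]]|[vw [x xv yw]]].
  rewrite partnerP // => /and3P[/eqP xv /eqP yw /eqP e].
  by split=> //; exists x; rewrite -?e.
split=> //; apply/existsP; exists x; apply/existsP; exists (partner M x).
by rewrite xv yw !eqxx partnerP /=.
Qed.

Lemma gdeg_erased_le M v : M \in perfect_matchings (copies deg) ->
  (gdeg (erased_graph M) v <= deg v)%N.
Proof.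
move=> Mp; rewrite -[deg v](big_set1 addn) -card_copies_of.
apply: leq_trans (leq_imset_card (fun x => tag (partner M x)) _).
apply/subset_leq_card/subsetP => w; rewrite inE => /(erased_adjP _ _ Mp)[_ [x xv <-]].
by apply: imset_f; rewrite !inE xv.
Qed.

(** Each of [m] neighbors selects a copy of [v] matched to it. Different neighbors select different
    copies, and no partner is a copy of [v] because [v] is not its own neighbor. *)
Lemma crowded_neighbors M v W m : M \in perfect_matchings (copies deg) ->
  (m <= #|W|)%N -> (forall w, w \in W -> erased_graph M v w) ->
  crowded (copies_of [set v]) m (copies_of W) M.
Proof.
move=> Mp /ex_subset_card[W' W'W <-] WN.
have ex w : w \in W' -> exists x : copies deg,
    [&& tag x == v, tag (partner M x) == w & v != w].
  move=> /(subsetP W'W)/WN/(erased_adjP _ _ Mp)[vw [x xv yw]].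
  by exists x; rewrite xv yw !eqxx.
have [W0|[w0 w0W]] := set_0Vmem W'.
  apply/existsP; exists set0; rewrite sub0set W0 !cards0 eqxx /=.
  by apply/forall_inP => x; rewrite inE.
have [x0 _] := ex _ w0W.
pose h w := odflt x0 [pick x : copies deg |
    [&& tag x == v, tag (partner M x) == w & v != w]].
have hP w : w \in W' ->
    [/\ tag (h w) = v, tag (partner M (h w)) = w & v != w].
  move=> /ex[x xP]; rewrite /h; case: pickP => [y /and3P[/eqP ? /eqP ? ?]//|].
  by move/(_ x); rewrite xP.
apply/existsP; exists (h @: W'); apply/andP; split; [apply/andP; split|].
- by apply/subsetP => _ /imsetP[w wW ->]; rewrite !inE; have [->] := hP _ wW.
- rewrite card_in_imset // => w w' wW wW' e.
  by have [_ <- _] := hP _ wW; have [_ <- _] := hP _ wW'; rewrite e.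
- apply/forall_inP => _ /imsetP[w wW ->]; have [h1 h2 h3] := hP _ wW.
  rewrite !inE h2 (subsetP W'W) // andbT; apply: contraNN h3.
  by case/imsetP => w' wW' e; rewrite -h2 e; have [->] := hP _ wW'.
Qed.

(* A pair of copies of [v] matched to each other contributes one of its two
   ends to [S], so that [partner M] maps [S] outside itself. *)
Lemma crowded_few_neighbors M v s j : M \in perfect_matchings (copies deg) ->
  (2 * s <= deg v)%N -> (gdeg (erased_graph M) v < j)%N ->
  exists g : {ffun 'I_j -> V},
    crowded (copies_of [set v]) s (copies_of [set w in codom g]) M.
Proof.
move=> Mp sd kj.
(* Of a pair inside [v], the end of smaller rank is kept. [S0] and its partners then cover the
   copies of [v], so [S0] has at least half of them. *)
pose S0 := [set x in copies_of [set v] | (tag (partner M x) != v) ||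
  (enum_rank x < enum_rank (partner M x))%N].
have cS0 : (deg v <= 2 * #|S0|)%N.
  rewrite -[deg v](big_set1 addn) -card_copies_of mulSn mul1n.
  apply: leq_trans (leq_add (leqnn _) (leq_imset_card (partner M) S0)).
  apply: leq_trans (leq_card_setU _ _).1.
  apply/subset_leq_card/subsetP => x xv; rewrite in_setU.
  case: (boolP (x \in S0)) => //= xS0; rewrite -(partnerK Mp x) imset_f //.
  move: xS0 xv; rewrite !inE partnerK // => + /eqP xv.
  rewrite xv eqxx negb_or negbK -leqNgt /= => /andP[-> /= le].
  rewrite ltn_neqAle le andbT; apply: contraNneq (partner_neq x Mp).
  by move/val_inj/enum_rank_inj => ->.
have /ex_subset_card[S SS0 cS] : (s <= #|S0|)%N by lia.
(* [v] is included because of the pairs inside [v]; hence [j] has to exceed the degree. *)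
pose W := v |: [set w | erased_graph M v w].
have cW : (#|W| <= j)%N.
  apply: leq_trans (leq_card_setU _ _).1 _; rewrite cards1; exact: kj.
(* Encoding [W] by a function on ['I_j] leaves [#|V| ^ j] candidates for the union bound. *)
pose g := [ffun i : 'I_j => nth v (enum W) i]; exists g.
have gW w : w \in W -> w \in codom g.
  move=> wW; have iW : (index w (enum W) < #|W|)%N.
    by rewrite cardE index_mem mem_enum.
  apply/codomP; exists (Ordinal (leq_trans iW cW)); rewrite ffunE /=.
  by rewrite nth_index // mem_enum.
apply/existsP; exists S; apply/andP; split.
  rewrite cS eqxx andbT; apply: subset_trans SS0 _.
  by apply/subsetP => x; rewrite inE => /andP[].
apply/forall_inP => x xS.
have /(subsetP SS0) := xS; rewrite !inE => /andP[/eqP xv xr].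
apply/andP; split.
  apply/negP => /(subsetP SS0); rewrite !inE partnerK // => /andP[/eqP pv pr].
  by move: pr xr; rewrite pv xv eqxx /=; lia.
apply: gW; rewrite !inE; case: eqVneq => //= pv.
by apply/erased_adjP => //; split; [rewrite eq_sym | exists x].
Qed.

End Copies.

Local Open Scope ring_scope.

(** * Real powers *)

Section RealPowers.
Variable R : realType.
Implicit Types (x y g e C : R).

Lemma powRDgt0 x g e : 0 < x -> x `^ (g + e) = x `^ g * x `^ e.
Proof. by move=> x0; rewrite powRD // (gt_eqF x0) implybT. Qed.

Lemma le_powR_nonpos x y e : 0 < x -> x <= y -> e <= 0 -> y `^ e <= x `^ e.
Proof.
move=> x0 xy e0; rewrite -[e]opprK !(powRN _ (- e)) lef_pV2 ?posrE ?powR_gt0 //.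
  by apply: ge0_ler_powR; rewrite ?nnegrE; lra.
exact: lt_le_trans xy.
Qed.

(** A mean value estimate without derivatives: for y = x + 1, (y / x)^(g - 1) is at least 1 + (g -
    1) ln (y / x), and ln (y / x) is at least 1 / y. *)
Lemma powR_diff_ge x g : 0 < x -> 1 < g ->
  (g - 1) * (x + 1) `^ (- g) <= x `^ (1 - g) - (x + 1) `^ (1 - g).
Proof.
move=> x0 g1; set y := x + 1; have y0 : 0 < y by rewrite /y; lra.
have ln_ge : y^-1 <= ln (y / x).
  rewrite -[y / x]invrK lnV ?posrE ?invr_gt0 ?divr_gt0 // invf_div lerNr.
  have -> : x / y = 1 + - y^-1 by rewrite /y; field; rewrite gt_eqF.
  apply: le_ln1Dx; rewrite ltrN2 invf_lt1 // /y; lra.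
have -> : x `^ (1 - g) = y `^ (1 - g) * (y / x) `^ (g - 1).
  rewrite powRM ?invr_ge0 ?ltW // -powR_inv1 ?ltW // -powRrM mulrA -powRDgt0 //.
  rewrite (_ : 1 - g + (g - 1) = 0) ?powRr0 ?mul1r; last by ring.
  by congr (_ `^ _); ring.
have -> : y `^ (- g) = y `^ (1 - g) * y^-1.
  by rewrite -powR_inv1 ?ltW // -powRDgt0 //; congr (_ `^ _); ring.
rewrite -[X in _ <= _ - X]mulr1 -mulrBr mulrCA ler_pM2l ?powR_gt0 //.
have le1 : 1 + (g - 1) * ln (y / x) <= (y / x) `^ (g - 1).
  by rewrite /powR gt_eqF ?divr_gt0 // expR_ge1Dx.
apply: le_trans (_ : (g - 1) * ln (y / x) <= _); last by lra.
by rewrite ler_pM2l //; lra.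
Qed.

(** [powR_diff_ge] bounds the term at [i + 1] by a telescoping difference; [i + 1 <= 2 i] moves this
    to the term at [i] at the cost of 2^g. *)
Lemma sum_powR_le g k N : 1 < g -> (0 < k)%N ->
  \sum_(k <= i < N) i%:R `^ (- g) <= 2 `^ g / (g - 1) * k%:R `^ (1 - g).
Proof.
move=> g1 k0; have C0 : 0 <= 2 `^ g / (g - 1).
  by rewrite divr_ge0 ?powR_ge0; lra.
have [Nk|kN] := leqP N k; first by rewrite big_geq // mulr_ge0 ?powR_ge0.
(* Subtracting the term at [N] strengthens the claim enough for induction. *)
apply: le_trans (_ : _ <= 2 `^ g / (g - 1) *
  (k%:R `^ (1 - g) - N%:R `^ (1 - g))) _; last first.
  by rewrite ler_wpM2l // lerBlDr lerDl powR_ge0.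
move/ltnW: kN; elim: N => [|N IH].
  by rewrite leqn0 => /eqP ek; rewrite ek in k0.
rewrite leq_eqVlt => /predU1P[<-|]; first by rewrite big_geq // subrr mulr0.
rewrite ltnS => kN; rewrite big_nat_recr //=.
apply: le_trans (lerD (IH kN) (lexx _)) _.
have N1 : 1 <= N%:R :> R by rewrite ler1n (leq_trans k0).
have N0 : 0 < N%:R :> R by lra.
rewrite -[N.+1%:R]natr1; have := powR_diff_ge N0 g1.
set u := N%:R `^ (1 - g); set w := (_ + 1) `^ (1 - g) => step.
suff : N%:R `^ (- g) <= 2 `^ g / (g - 1) * (u - w).
  by set D := 2 `^ g / (g - 1); rewrite !mulrBr => ?; lra.
apply: le_trans (_ : 2 `^ g * (N%:R + 1) `^ (- g) <= _); last first.
  by rewrite -mulrA ler_pM2l ?powR_gt0 // mulrC ler_pdivlMr 1?mulrC //; lra.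
have -> : N%:R `^ (- g) = 2 `^ g * (2 * N%:R) `^ (- g).
  by rewrite powRM ?ler0n // mulrA -powRDgt0 ?ltr0n // subrr powRr0 mul1r.
rewrite ler_pM2l ?powR_gt0 // le_powR_nonpos //; lra.
Qed.

Lemma powR_unbounded e C : 0 < e -> exists n0, forall n : nat, (n0 <= n)%N ->
  C <= n%:R `^ e.
Proof.
move=> e0; exists (Num.truncn (`|C| `^ e^-1)).+1 => n nn.
apply: le_trans (ler_norm C) _.
have -> : `|C| = (`|C| `^ e^-1) `^ e.
  by rewrite -powRrM mulVf ?gt_eqF // powRr1.
apply: ge0_ler_powR; rewrite ?nnegrE ?powR_ge0 ?ler0n ?(ltW e0) //.
by apply/ltW/(lt_le_trans (truncnS_gt _)); rewrite ler_nat.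
Qed.

Lemma powR_log2 x : 0 < x -> 2 `^ (log2 x) = x.
Proof.
move=> x0; rewrite /powR pnatr_eq0 /= /log2 divfK ?lnK //.
by rewrite gt_eqF // ln_gt0 // ltr1n.
Qed.

Lemma log2_ge1 x : 2 <= x -> 1 <= log2 x.
Proof.
move=> x2; rewrite /log2 ler_pdivlMr ?ln_gt0 ?ltr1n // mul1r ler_ln ?posrE //.
lra.
Qed.

End RealPowers.

(** * Power-law degree sequences *)

Section EvenDegrees.
Variables (n : nat) (deg : 'I_n -> nat).

Lemma even_deg_lshift (i : 'I_n) : even_deg (deg := deg) (lshift _ i) = deg i.
Proof. by rewrite /even_deg (unsplitK (inl i)). Qed.

Lemma even_deg_rshift i : even_deg (deg := deg) (rshift n i) = 1%N.
Proof. by rewrite /even_deg (unsplitK (inr i)). Qed.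

Lemma sum_even_deg (A : nmodType) (Q : pred nat) (F : nat -> A) :
  \sum_(v : 'I_(nvert deg) | Q (even_deg v)) F (even_deg v) =
  \sum_(i < n | Q (deg i)) F (deg i) +
  \sum_(i < odd (\sum_(i < n) deg i) | Q 1%N) F 1%N.
Proof.
rewrite big_split_ord /=; congr (_ + _).
  by apply: eq_big => [i|i _]; rewrite even_deg_lshift.
by apply: eq_big => [i|i _]; rewrite even_deg_rshift.
Qed.

Lemma card_copies_even_deg :
  #|copies (@even_deg n deg)| =
  (\sum_(i < n) deg i + odd (\sum_(i < n) deg i))%N.
Proof.
rewrite card_copies (sum_even_deg xpredT id); congr addn.
by rewrite sum1_card card_ord.
Qed.

Lemma even_card_copies : ~~ odd #|copies (@even_deg n deg)|.
Proof. by rewrite card_copies_even_deg oddD oddb addbb. Qed.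

Lemma nvert_le2 : (0 < n)%N -> (n <= nvert deg <= 2 * n)%N.
Proof. by rewrite /nvert; case: odd => /= n0; lia. Qed.

End EvenDegrees.

Section PowerLawDegrees.
Variables (R : realType) (a b alpha : R) (n : nat) (deg : 'I_n -> nat).
Hypotheses (n0 : (0 < n)%N) (b0 : 0 < b).
Hypothesis Hdeg : power_law_degrees a b alpha deg.

(** Used with [p = 0] to count vertices and [p = 1] to count copies. Degree d contributes at most b
    n d^(p - alpha), summed by [sum_powR_le]; the summand 1 in the constant pays for the extra
    vertex. *)
Lemma even_deg_moment (p k : nat) : 1 < alpha - p%:R -> (0 < k)%N ->
  \sum_(v : 'I_(nvert deg) | (k <= even_deg v)%N) (even_deg v)%:R ^+ p <=
  (1 + b * (2 `^ (alpha - p%:R) / (alpha - p%:R - 1))) * n%:R *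
  k%:R `^ (1 - (alpha - p%:R)).
Proof.
set g := alpha - p%:R => g1 k0; set E := 2 `^ g / _.
rewrite (sum_even_deg deg (leq k) (fun d => d%:R ^+ p)).
rewrite [in leRHS]mulrDl [in leRHS]mulrDl mul1r addrC.
apply: lerD.
  have [k1|k1] := leqP k 1; last by rewrite big_pred0_eq mulr_ge0 ?powR_ge0.
  have -> : k = 1%N by lia.
  rewrite powR1 mulr1 expr1n sumr_const card_ord ler_nat.
  by apply: leq_trans n0; case: odd.
have [B degB] : exists B, forall i, (deg i < B.+1)%N.
  by exists (\max_i deg i) => i; rewrite ltnS leq_bigmax.
rewrite (partition_big (fun i => inord (deg i) : 'I_B.+1)
  (fun d : 'I_B.+1 => (k <= d)%N));
  last by move=> i; rewrite inordK.
apply: le_trans (_ : _ <= \sum_(d < B.+1 | (k <= d)%N) b * n%:R * d%:R `^ (- g)) _.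
  apply: ler_sum => d kd; have d0 := leq_trans k0 kd.
  have [_ Nd] := Hdeg d0.
  rewrite (eq_bigr (fun _ => d%:R ^+ p : R)); last first.
    by move=> i /andP[_ /eqP <-]; rewrite inordK.
  rewrite (eq_bigl [in [set i | deg i == d]]); last first.
    move=> i; rewrite inE -val_eqE /= inordK //.
    by case: eqP => [->|]; rewrite ?kd ?andbF.
  rewrite sumr_const -[_ *+ #|_|]mulr_natl.
  apply: (@le_trans _ _ (b * (n%:R / d%:R `^ alpha) * d%:R ^+ p)).
    by rewrite ler_wpM2r ?exprn_ge0.
  rewrite -!mulrA ler_pM2l // ler_wpM2l // -powRN -powR_mulrn // -powRDgt0 ?ltr0n //.
  by rewrite (_ : - alpha + p%:R = - g) // /g; ring.
rewrite -mulr_sumr -(big_geq_mkord k B.+1 xpredT (fun d => d%:R `^ (- g))).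
rewrite [leRHS](_ : _ = b * n%:R * (E * k%:R `^ (1 - g))); last by ring.
by rewrite ler_wpM2l ?sum_powR_le // mulr_ge0 // ltW.
Qed.

(** A positive degree d that occurs has count at least 1, which forces b n / d^alpha >= 1. Replacing
    b by 1 + b makes the bound at least 1, which covers the extra vertex. *)
Lemma even_deg_le (v : 'I_(nvert deg)) : 0 < alpha ->
  (even_deg v)%:R <= ((1 + b) * n%:R) `^ alpha^-1.
Proof.
move=> al0; have nn : 1 <= n%:R :> R by rewrite ler1n.
have le1 x : 1 <= x -> 1 <= x `^ alpha^-1.
  by move=> x1; rewrite -(powRr0 x) ler_powR // invr_ge0 ltW.
rewrite -(splitK v); case: (split v) => i; rewrite /= ?even_deg_lshift ?even_deg_rshift.
  have [->|d0] := posnP (deg i); first by rewrite powR_ge0.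
  have [_ Nd] := Hdeg d0; have dR : 0 < (deg i)%:R :> R by rewrite ltr0n.
  have {}Nd : 1 <= b * (n%:R / (deg i)%:R `^ alpha).
    apply: le_trans Nd; rewrite ler1n card_gt0; apply/set0Pn; exists i.
    by rewrite inE.
  have -> : (deg i)%:R = ((deg i)%:R `^ alpha) `^ alpha^-1 :> R.
    by rewrite -powRrM mulfV ?gt_eqF // powRr1 // ltW.
  apply: ge0_ler_powR; rewrite ?nnegrE ?powR_ge0 ?invr_ge0 ?(ltW al0) //.
    by rewrite mulr_ge0 //; have := b0; lra.
  move: Nd; rewrite mulrA ler_pdivlMr ?powR_gt0 // mul1r => /le_trans; apply.
  by rewrite ler_wpM2r //; lra.
apply: le1; rewrite mulrDl mul1r; apply: le_trans nn _; rewrite lerDl mulr_ge0 //.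
exact: ltW.
Qed.

(** The vertices of degree 1 suffice; rounding down loses at most 1 <= a n / 2. *)
Lemma card_copies_ge : 2 <= a * n%:R ->
  a / 2 * n%:R <= #|copies (@even_deg n deg)|%:R :> R.
Proof.
move=> an; have [+ _] := Hdeg (ltn0Sn 0).
rewrite powR1 divr1 => N1; apply: le_trans (_ : (Num.truncn (a * n%:R))%:R <= _).
  have := truncnS_gt (a * n%:R); rewrite -natr1; lra.
rewrite ler_nat (leq_trans N1) // card_copies_even_deg.
apply: leq_trans (leq_addr _ _); rewrite -sum1dep_card big_mkcond /=.
by apply: leq_sum => i _; case: eqP => // ->.
Qed.

Lemma matchingsE : matchings deg = perfect_matchings (copies (@even_deg n deg)).
Proof. by []. Qed.

Lemma PLB_erased M : 1 < alpha -> M \in matchings deg ->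
  PLB ((1 + b * (2 `^ alpha / (alpha - 1))) * 2 `^ alpha) alpha 0
    (erased_graph M).
Proof.
move=> al1 Mp d; set E := 2 `^ alpha / _; rewrite add0r powR1 mulr1.
have d0 : (0 < 2 ^ d)%N by rewrite expn_gt0.
have E0 : 0 <= 1 + b * E.
  rewrite addr_ge0 // mulr_ge0 ?(ltW b0) // divr_ge0 ?powR_ge0 //; lra.
apply: le_trans (_ : (1 + b * E) * n%:R * (2 ^ d)%:R `^ (1 - alpha) <= _).
  have := @even_deg_moment 0 (2 ^ d); rewrite subr0 => /(_ al1 d0); apply: le_trans.
  rewrite -sum1dep_card natr_sum [leLHS]big_mkcond [leRHS]big_mkcond /=.
  apply: ler_sum => v _; rewrite expr0.
  case: andP => [[dv _]|_]; last by case: ifP.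
  by rewrite (leq_trans dv) // gdeg_erased_le // -matchingsE.
rewrite card_ord; set N := (nvert deg)%:R; set K := (2 ^ d)%N.
have nN : n%:R <= N by rewrite ler_nat; have /andP[] := nvert_le2 deg n0.
have K0 : 0 < K%:R :> R by rewrite ltr0n.
apply: le_trans (_ : (1 + b * E) * N * K%:R `^ (1 - alpha) <= _).
  by rewrite ler_wpM2r ?powR_ge0 // ler_wpM2l.
rewrite [leRHS](_ : _ = (1 + b * E) * N * (2 `^ alpha *
  \sum_(K <= i < 2 ^ d.+1) (i%:R + 0) `^ (- alpha))); last by ring.
rewrite ler_wpM2l ?mulr_ge0 //.
(* Each of the [K] terms of the dyadic block is at least (2 K)^(- alpha). *)
have -> : K%:R `^ (1 - alpha) =
    2 `^ alpha * (\sum_(K <= i < 2 ^ d.+1) (2 * K%:R) `^ (- alpha)).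
  rewrite sumr_const_nat expnS mulSn mul1n addnK powRM // powRDgt0 //.
  rewrite powRr1 ?ltW // -[(_ * _) *+ K]mulr_natl mulrCA.
  by congr (_ * _); rewrite mulrA -powRDgt0 // subrr powRr0 mul1r.
rewrite ler_pM2l ?powR_gt0 //; apply: ler_sum_nat => i /andP[Ki iK].
rewrite addr0 le_powR_nonpos //; last by lra.
  by rewrite (lt_le_trans K0) // ler_nat.
by rewrite -natrM ler_nat -expnS ltnW.
Qed.
End PowerLawDegrees.

(** * Crowded neighborhoods *)

Lemma bin_le_exp2 n m : ('C(n, m) <= 2 ^ n)%N.
Proof.
elim: n m => [|n IH] [|m] //; first by rewrite bin0 expn_gt0.
by rewrite binS expnS mul2n -addnn leq_add.
Qed.

Lemma expn_le_ffact n m : (n ^ m <= (n + m) ^_ m)%N.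
Proof.
elim: m => [|m IH]; first by rewrite ffactn0.
by rewrite expnS addnS ffactSS leq_mul // leqW // leq_addr.
Qed.

Lemma ffact_le_expn n m : (n ^_ m <= n ^ m)%N.
Proof.
elim: m n => [|m IH] n; first by rewrite ffactn0.
case: n => [|n]; first by rewrite ffact0n.
rewrite ffactSS expnS leq_mul2l /= (leq_trans (IH n)) //.
by case: m {IH} => // m; rewrite leq_exp2r.
Qed.

(* [m ^ m <= 'C(2 m, m) * m! <= 4 ^ m * m!] *)
Lemma bin_mul_expn_le n m : ('C(n, m) * m ^ m <= (4 * n) ^ m)%N.
Proof.
apply: (@leq_trans ('C(n, m) * (4 ^ m * m`!))).
  rewrite leq_mul2l; apply/orP; right.
  apply: leq_trans (expn_le_ffact m m) _.
  rewrite -bin_ffact leq_mul2r (_ : 4 = 2 ^ 2)%N // -expnM mulSn mul1n.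
  by rewrite bin_le_exp2 orbT.
by rewrite mulnCA bin_ffact expnMn leq_mul2l ffact_le_expn orbT.
Qed.

Section CrowdedBounds.
Variables (V : finType) (deg : V -> nat).
Local Notation T := (copies deg).

(** [card_crowded] and [bin_mul_expn_le] bound the proportion by (8 D #|Y| / (m #|T|))^m with D =
    [deg v]; the last hypothesis makes the base at most 1 / 2. *)
Lemma card_crowded_small v m (Y : {set T}) :
  (0 < m)%N -> (0 < #|T|)%N -> (4 * deg v <= #|T|)%N ->
  (16 * deg v * #|Y| <= m * #|T|)%N ->
  (#|[set M in perfect_matchings T | crowded (copies_of deg [set v]) m Y M]| *
   2 ^ m <= #|perfect_matchings T|)%N.
Proof.
move=> m0 T0 dT YT; have cX : #|copies_of deg [set v]| = deg v.
  by rewrite card_copies_of big_set1.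
have := @card_crowded T (copies_of deg [set v]) m Y; rewrite cX => /(_ dT).
set A := #|_|; set P := #|perfect_matchings T| => h.
have mT : (0 < (m * #|T|) ^ m)%N by rewrite expn_gt0 muln_gt0 m0 T0.
rewrite -(leq_pmul2r mT).
apply: (@leq_trans ('C(deg v, m) * ((2 * #|Y|) ^ m * P) * (2 * m) ^ m)).
  rewrite (_ : _ * _ = (A * #|T| ^ m) * (2 * m) ^ m)%N; last first.
    by rewrite !expnMn; ring.
  by rewrite leq_mul2r h orbT.
rewrite (_ : _ * _ = ('C(deg v, m) * m ^ m) * ((4 * #|Y|) ^ m * P))%N; last first.
  by rewrite (_ : 4 = 2 * 2)%N // !expnMn; ring.
apply: leq_trans (leq_mul (bin_mul_expn_le _ _) (leqnn _)) _.
rewrite mulnA -expnMn mulnC leq_mul2l; apply/orP; right.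
by rewrite leq_exp2r //; lia.
Qed.

Lemma card_crowded_codom v s j B : (4 * deg v <= #|T|)%N ->
  (forall w, deg w <= B)%N ->
  (#|[set M in perfect_matchings T | [exists g : {ffun 'I_j -> V},
       crowded (copies_of deg [set v]) s (copies_of deg [set w in codom g]) M]]| *
   #|T| ^ s <=
   #|V| ^ j * (2 ^ deg v * ((2 * (j * B)) ^ s * #|perfect_matchings T|)))%N.
Proof.
move=> dT dB; have cX : #|copies_of deg [set v]| = deg v.
  by rewrite card_copies_of big_set1.
have /= h := card_exists_le (perfect_matchings T) xpredT
  (fun g : {ffun 'I_j -> V} =>
     crowded (copies_of deg [set v]) s (copies_of deg [set w in codom g])).
apply: leq_trans (leq_mul h (leqnn _)) _ => {h}.
rewrite big_distrl /= (_ : #|V| ^ j = #|{ffun 'I_j -> V}|)%N; last first.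
  by rewrite card_ffun card_ord.
rewrite -sum_nat_const; apply: leq_sum => g _.
have := @card_crowded T (copies_of deg [set v]) s (copies_of deg [set w in codom g]).
rewrite cX => /(_ dT)/leq_trans; apply.
apply: leq_mul; first exact: bin_le_exp2.
rewrite leq_mul2r; apply/orP; right.
have [->//|s0] := posnP s; rewrite leq_exp2r // leq_mul2l /= card_copies_of.
apply: (@leq_trans (\sum_(w in [set w in codom g]) B)); first exact: leq_sum.
rewrite sum_nat_const leq_mul2r; apply/orP; right.
rewrite cardsE; apply: leq_trans (leq_image_card _ _) _.
by rewrite card_ord.
Qed.

(** The deterministic step. If D > q k, there are so few neighbors that the second hypothesis fails.
    Otherwise neighbors of erased degree at least k satisfy [D <= q * deg w], a condition
    independent of the matching, as the union bound requires. *)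
Lemma not_crowded_neighbors M v q K m : M \in perfect_matchings T ->
  (0 < q)%N -> let D := deg v in let k := gdeg (erased_graph M) v in
  ~~ crowded (copies_of deg [set v]) m
       (copies_of deg [set w | D <= q * deg w]%N) M ->
  ((K <= D)%N -> ~~ [exists g : {ffun 'I_(D %/ q)%N.+1 -> V},
     crowded (copies_of deg [set v]) (D %/ 2)%N
       (copies_of deg [set w in codom g]) M]) ->
  (K <= k)%N -> (D <= q * k)%N /\
    (#|[set w | erased_graph M v w && (k <= gdeg (erased_graph M) w)%N]| < m)%N.
Proof.
move=> Mp q0 D k small codom Kk.
have kD : (k <= D)%N := gdeg_erased_le v Mp.
have Dk : (D <= q * k)%N.
  rewrite leqNgt; apply/negP => kq.
  have /negP := codom (leq_trans Kk kD); apply; apply/existsP => /=.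
  apply: crowded_few_neighbors => //; first by rewrite mulnC leq_trunc_div.
  by rewrite ltnS leq_divRL // mulnC ltnW.
split=> //; rewrite ltnNge; apply: contraNN small => mW.
apply: crowdedS (crowded_neighbors Mp mW _); last first.
  by move=> w; rewrite inE => /andP[].
apply/subsetP => x; rewrite !inE => /andP[_ kx].
by apply: leq_trans Dk _; rewrite leq_mul2l (leq_trans kx) ?orbT // gdeg_erased_le.
Qed.

End CrowdedBounds.

(** For s = D / 2 and j = D / q + 1: q j <= D + q <= 2 D <= 6 s. *)
Lemma divn_bounds D q : (1 < q)%N -> (q <= D)%N ->
  [/\ D <= 3 * (D %/ 2), q * (D %/ q).+1 <= 6 * (D %/ 2) & (D %/ q).+1 <= D]%N.
Proof.
move=> q1 qD; have Ds : (D <= 3 * (D %/ 2))%N by lia.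
split=> //; last by apply: leq_ltn_trans (ltn_Pdiv q1 _); lia.
by have := leq_trunc_div D q; rewrite mulnS mulnC; lia.
Qed.

(** [k] is D / q rounded up, which puts [D <= q * w] in the form of a degree tail. *)
Lemma ceil_divn D q : (0 < q)%N -> (0 < D)%N ->
  exists2 k, (0 < k)%N & (D <= q * k)%N /\
    (forall w, (D <= q * w)%N -> (k <= w)%N).
Proof.
move=> q0 D0; exists (D.-1 %/ q).+1 => //; split.
  by have := ltn_ceil D.-1 q0; rewrite mulnC; lia.
by move=> w Dw; rewrite ltn_divLR // mulnC; lia.
Qed.

(** * Polynomially small failure probabilities at one vertex *)

Section PolynomiallySmall.
Variables (R : realType) (alpha c C : R) (V : finType) (deg : V -> nat).
Local Notation T := (copies deg).
Local Notation N := (#|V|%:R : R).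

(** The tail bound at degree D / q controls [#|Y|], so the second lower bound on [m] allows
    [card_crowded_small]; the first one gives 2^m >= N^3. *)
Lemma card_crowded_poly (q m : nat) v : 2 < alpha -> 0 < c -> 0 < C ->
  (0 < q)%N -> 2 <= N -> c * N <= #|T|%:R -> (4 * deg v <= #|T|)%N ->
  (forall k, (0 < k)%N ->
    \sum_(w | (k <= deg w)%N) (deg w)%:R <= C * N * k%:R `^ (2 - alpha)) ->
  3 * log2 N <= m%:R ->
  16 * C * q%:R `^ (alpha - 2) / c * ((deg v)%:R * (deg v)%:R `^ (2 - alpha))
    <= m%:R ->
  #|[set M in perfect_matchings T | crowded (copies_of deg [set v]) m
       (copies_of deg [set w | deg v <= q * deg w]%N) M]|%:R * N ^+ 3 <=
  #|perfect_matchings T|%:R.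
Proof.
move=> al2 c0 C0 q0 N2 LN dT tail lm Em; set Y := copies_of _ [set w | _].
have N0 : 0 < N by lra.
have l1 := log2_ge1 N2.
have m0 : (0 < m)%N by rewrite -(ltr0n R); lra.
have T0 : (0 < #|T|)%N by rewrite -(ltr0n R) (lt_le_trans _ LN) // mulr_gt0.
have YT : (16 * deg v * #|Y| <= m * #|T|)%N.
  have [->|d0] := posnP (deg v); first by rewrite muln0 mul0n.
  have [k k0 [dk kP]] := ceil_divn q0 d0.
  have dR : 0 < (deg v)%:R :> R by rewrite ltr0n.
  have qR : 0 < q%:R :> R by rewrite ltr0n.
  have Yle : #|Y|%:R <= C * N * (q%:R `^ (alpha - 2) * (deg v)%:R `^ (2 - alpha)).
    apply: le_trans (_ : C * N * k%:R `^ (2 - alpha) <= _).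
      apply: le_trans (tail _ k0); rewrite card_copies_of natr_sum.
      rewrite [leLHS]big_mkcond [leRHS]big_mkcond; apply: ler_sum => w _.
      by rewrite inE; case: ifP => [/kP ->//|_]; case: ifP.
    rewrite ler_pM2l ?mulr_gt0 //.
    apply: le_trans (_ : ((deg v)%:R / q%:R) `^ (2 - alpha) <= _).
      apply: le_powR_nonpos; [exact: divr_gt0| |lra].
      by rewrite ler_pdivrMr // -natrM ler_nat mulnC.
    rewrite powRM ?invr_ge0 ?(ltW dR) ?(ltW qR) //.
    rewrite [leLHS]mulrC ler_pM2r ?powR_gt0 //.
    rewrite -powR_inv1 ?(ltW qR) // -powRrM.
    by rewrite (_ : -1 * (2 - alpha) = alpha - 2) //; ring.
  rewrite -(ler_nat R) !natrM.
  apply: le_trans (_ : m%:R * (c * N) <= _); last by rewrite ler_wpM2l.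
  apply: le_trans (ler_wpM2l _ Yle) _; first by rewrite mulr_ge0 // ltW.
  have cN : 0 < c * N by rewrite mulr_gt0.
  apply: le_trans (ler_wpM2r (ltW cN) Em).
  rewrite le_eqVlt; apply/orP; left; apply/eqP; field.
  by rewrite gt_eqF.
have := card_crowded_small m0 T0 dT YT; rewrite -(ler_nat R) natrM.
apply: le_trans; rewrite ler_wpM2l // natrX -!powR_mulrn //.
rewrite -{1}(powR_log2 N0) -powRrM ler_powR ?ler1n //.
by rewrite mulrC.
Qed.

(* With [s = D / 2] and [j = D / q + 1 <= 6 s / q], the union bound
   [n ^ j * 2 ^ D * (2 j B / L) ^ s] is at most
   [(O(n ^ (6 / q + 2 / alpha - 1))) ^ s], whose exponent is negative. *)
Lemma card_crowded_codom_poly (q : nat) (eta : R) v : 0 < alpha -> 0 < c ->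
  0 < C -> 2 <= N -> c * N <= #|T|%:R -> (4 * deg v <= #|T|)%N ->
  (forall w, (deg w)%:R <= C * N `^ alpha^-1) ->
  0 < eta -> 2 / alpha = 1 - 3 * eta -> (1 < q)%N -> 6 / eta <= q%:R ->
  16 * C ^+ 2 <= c * N `^ eta -> (q <= deg v)%N -> 9 / eta <= (deg v)%:R ->
  #|[set M in perfect_matchings T |
      [exists g : {ffun 'I_(deg v %/ q)%N.+1 -> V},
        crowded (copies_of deg [set v]) (deg v %/ 2)%N
          (copies_of deg [set w in codom g]) M]]|%:R * N ^+ 3 <=
  #|perfect_matchings T|%:R.
Proof.
move=> al0 c0 C0 N2 LN dT dmax eta0 eal q1 qeta Neta qD Deta.
set D := deg v in dT qD Deta *; set s := (D %/ 2)%N; set j := (D %/ q).+1.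
have N0 : 0 < N by lra.
set Del := C * N `^ alpha^-1 in dmax.
have Del0 : 0 <= Del by rewrite mulr_ge0 ?powR_ge0 ?ltW.
have dB w : (deg w <= Num.truncn Del)%N by rewrite truncn_ge_nat.
have := card_crowded_codom s j dT dB; rewrite -(ler_nat R).
set A := #|_|; set P := #|perfect_matchings T|; set B := Num.truncn Del.
have [Ds qj jD] := divn_bounds q1 qD.
(* This finally turns N^(- eta s) into at most N^(-3). *)
have etas : 3 <= eta * s%:R.
  move: Deta; rewrite ler_pdivrMr // => h.
  have : D%:R <= 3 * s%:R :> R by rewrite -natrM ler_nat.
  by rewrite -(ler_pM2l eta0); lra.
rewrite !natrM !natrX => h.
have Nj : N ^+ j <= (N `^ eta) ^+ s.
  rewrite -!powR_mulrn ?powR_ge0 ?(ltW N0) // -powRrM ler_powR //; first by lra.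
  have : q%:R * j%:R <= 6 * s%:R :> R by rewrite -!natrM ler_nat.
  have qR : 0 < q%:R :> R by rewrite ltr0n ltnW.
  move: qeta; rewrite ler_pdivrMr // => qe qjs.
  rewrite -(ler_pM2l qR); apply: le_trans qjs _; rewrite mulrA.
  by rewrite ler_wpM2r.
(* Both [j <= D] and [B] are at most the degree bound [Del]. *)
have B2 : 2 * (j%:R * B%:R) <= 2 * (C ^+ 2 * N `^ (2 / alpha)) :> R.
  rewrite ler_pM2l // (_ : 2 / alpha = alpha^-1 + alpha^-1); last by ring.
  rewrite powRDgt0 // [leRHS](_ : _ = Del * Del); last by rewrite /Del; ring.
  rewrite ler_pM // ?truncn_le //.
  by apply: le_trans (dmax v); rewrite ler_nat.
have cN0 : 0 < (c * N) ^+ s by rewrite exprn_gt0 // mulr_gt0.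
(* Per unit of [s]: N^eta for the choice of [g], 8 for the sets of copies since 2^D <= 8^s, and 2
   C^2 N^(1 - 3 eta) for the target. As 16 C^2 <= c N^eta, the product is at most c N^(1 - eta). *)
have {}h : A%:R * (c * N) ^+ s <= (c * N) ^+ s * (N `^ (- eta)) ^+ s * P%:R.
  apply: le_trans (_ : A%:R * #|T|%:R ^+ s <= _).
    rewrite ler_wpM2l // lerXn2r // ?nnegrE //.
    by apply: mulr_ge0; exact: ltW.
  apply: le_trans h _.
  apply: le_trans (_ : (N `^ eta) ^+ s * (8 ^+ s *
      ((2 * (C ^+ 2 * N `^ (2 / alpha))) ^+ s * P%:R)) <= _).
    apply: ler_pM; rewrite ?(exprn_ge0, mulr_ge0) //.
    apply: ler_pM; rewrite ?(exprn_ge0, mulr_ge0) //.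
      rewrite (_ : 8 = 2 ^+ 3); last by ring.
      by rewrite -exprM ler_eXn2l // ltr1n.
    rewrite ler_wpM2r // lerXn2r ?nnegrE ?mulr_ge0 ?powR_ge0 ?(ltW C0) //.
    by rewrite !natrM.
  rewrite !mulrA -!exprMn ler_wpM2r // lerXn2r ?nnegrE //.
  - by rewrite !mulr_ge0 ?powR_ge0 ?(ltW C0).
  - by rewrite !mulr_ge0 ?powR_ge0 ?ltW.
  - rewrite eal [leLHS](_ : _ =
      16 * C ^+ 2 * (N `^ eta * N `^ (1 - 3 * eta))); last by ring.
    rewrite -powRDgt0 //; apply: le_trans (ler_wpM2r _ Neta) _; first exact: powR_ge0.
    rewrite -[X in _ <= c * X * _]powRr1 ?(ltW N0) // -!mulrA -!powRDgt0 //.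
    by rewrite (_ : eta + (eta + (1 - 3 * eta)) = 1 - eta) //; ring.
have {}h : A%:R <= (N `^ (- eta)) ^+ s * P%:R.
  by rewrite -(ler_pM2r cN0) (le_trans h) // [leRHS]mulrC mulrA.
have N30 : 0 < N ^+ 3 by rewrite exprn_gt0.
apply: le_trans (ler_wpM2r (ltW N30) h) _.
rewrite -[leRHS]mul1r mulrAC ler_wpM2r //.
rewrite -!powR_mulrn ?powR_ge0 ?(ltW N0) // -powRrM -powRDgt0 //.
rewrite -[leRHS](powRr0 N) ler_powR //; first by lra.
by rewrite mulNr; lra.
Qed.

End PolynomiallySmall.

(** * High-degree neighbors in the erased graph *)

Section Neighborhoods.
Variables (R : realType) (alpha : R).

(** The terms with k <= i < 2 k suffice, each being at least (2 k)^(1 - alpha). *)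
Lemma sum_powR_ge (k N : nat) : 2 < alpha -> (0 < k)%N -> (2 * k <= N)%N ->
  k%:R * k%:R `^ (2 - alpha) <= 2 `^ (alpha - 1) *
    ((0 + 1) `^ (alpha - 2) * k%:R *
      \sum_(k <= i < N) i%:R * (i%:R + 0) `^ (- alpha)).
Proof.
move=> al2 k0 kN; rewrite add0r powR1 mul1r mulrCA ler_pM2l ?ltr0n //.
have kR : 0 < k%:R :> R by rewrite ltr0n.
have Fge0 (i : nat) : 0 <= i%:R * (i%:R + 0) `^ (- alpha) :> R.
  by rewrite mulr_ge0 ?powR_ge0.
apply: le_trans (_ : 2 `^ (alpha - 1) *
  (\sum_(k <= i < 2 * k) (2 * k%:R) `^ (1 - alpha)) <= _).
  rewrite sumr_const_nat mulSn mul1n addnK powRM // -[(_ * _) *+ k]mulr_natl.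
  rewrite mulrCA [X in _ <= _ * X]mulrA -powRDgt0 //.
  rewrite (_ : alpha - 1 + (1 - alpha) = 0) ?powRr0 ?mul1r; last by ring.
  rewrite -[X in _ <= X * _]powRr1 ?(ltW kR) // -powRDgt0 //.
  by rewrite (_ : 1 + (1 - alpha) = 2 - alpha) //; ring.
rewrite ler_pM2l ?powR_gt0 // (big_cat_nat _ kN) /=; last by lia.
apply: ler_wpDr; first exact: sumr_ge0.
apply: ler_sum_nat => i /andP[ki ik].
have iR : 0 < i%:R :> R by rewrite ltr0n (leq_trans k0).
rewrite addr0 -{1}[i%:R]powRr1 ?(ltW iR) // -powRDgt0 //.
apply: le_powR_nonpos => //; last by lra.
by rewrite -natrM ler_nat ltnW.
Qed.

(** Boolean, so that the failing matchings form a set; [0 + 1] and [+ 0] keep it convertible with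
    [PLB_neighborhoods] at t = 0. *)
Definition few_high_neighbors (c2 : R) (V : finType) (G : sgraph V) (v : V) : bool :=
  let k := gdeg G v in
  #|[set w | G v w && (k <= gdeg G w)%N]|%:R <=
  c2 * Num.max (log2 (#|V|%:R : R))
    ((0 + 1) `^ (alpha - 2) * k%:R *
      \sum_(k <= i < #|V|) i%:R * (i%:R + 0) `^ (- alpha)).

Lemma erased_few_high_neighbors (c C : R) : 2 < alpha -> 0 < c -> 0 < C ->
  exists2 c2, 0 < c2 & exists n0, forall (V : finType) (deg : V -> nat),
    (n0 <= #|V|)%N -> c * #|V|%:R <= #|copies deg|%:R ->
    (forall v, (deg v)%:R <= C * #|V|%:R `^ alpha^-1) ->
    (forall k, (0 < k)%N -> \sum_(w | (k <= deg w)%N) (deg w)%:R <=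
       C * #|V|%:R * k%:R `^ (2 - alpha)) ->
    #|[set M in perfect_matchings (copies deg) |
       ~~ [forall v, few_high_neighbors c2 (erased_graph M) v]]|%:R * #|V|%:R <=
    #|perfect_matchings (copies deg)|%:R :> R.
Proof.
move=> al2 c0 C0; have al0 : 0 < alpha by lra.
(* Of the positive gap 1 - 2 / alpha, one third pays for the choice of [g], one for the constants,
   and one is the gain. *)
pose eta := (1 - 2 / alpha) / 3.
have eta0 : 0 < eta by rewrite divr_gt0 // subr_gt0 ltr_pdivrMr // mul1r.
have eal : 2 / alpha = 1 - 3 * eta by rewrite /eta; field; rewrite gt_eqF.
pose q := (Num.truncn (6 / eta)).+2.
have qeta : 6 / eta <= q%:R.
  by apply/ltW/(lt_trans (truncnS_gt _)); rewrite ltr_nat.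
(* [K] meets both lower bounds on the degree in [card_crowded_codom_poly]. *)
have [K Kdef] : exists K, K = (q + (Num.truncn (9 / eta)).+1)%N by eexists.
have [E Edef] : exists E, E = 16 * C * q%:R `^ (alpha - 2) / c by eexists.
have E0 : 0 < E by rewrite Edef divr_gt0 // !mulr_gt0 // powR_gt0 // ltr0n.
have [A Adef] : exists A : R, A = 2 `^ (alpha - 1) by eexists.
have A0 : 0 < A by rewrite Adef powR_gt0.
(* [4] pays for the logarithm in [m v], the product for its other term, and [K] for vertices of
   erased degree below [K]. *)
exists (4 + E * q%:R * A + K%:R).
  by rewrite !(addr_gt0, mulr_gt0, ltr0n) // Kdef.
have ial1 : 0 < 1 - alpha^-1.
  by rewrite subr_gt0 invf_lt1 //; lra.
(* [n1] keeps degrees below a quarter of the copies, [n2] below half of the vertices, and [n3]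
   absorbs the constant 16 C^2. *)
have [n1 n1P] := powR_unbounded (4 * C / c) ial1.
have [n2 n2P] := powR_unbounded (2 * C) ial1.
have [n3 n3P] := powR_unbounded (16 * C ^+ 2 / c) eta0.
exists (2 + n1 + n2 + n3)%N => V deg nV LN dmax tail.
set N := #|V|%:R : R in LN dmax tail *.
have N2 : 2 <= N by rewrite (ler_nat _ 2); clear -nV; lia.
have N0 : 0 < N by lra.
have Npow : N = N `^ (1 - alpha^-1) * N `^ alpha^-1.
  by rewrite -powRDgt0 // subrK powRr1 // (ltW N0).
have dT v : (4 * deg v <= #|copies deg|)%N.
  rewrite -(ler_nat R) natrM; apply: le_trans LN.
  apply: le_trans (ler_wpM2l _ (dmax v)) _ => //.
  have : 4 * C / c <= N `^ (1 - alpha^-1) by apply: n1P; clear -nV; lia.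
  rewrite ler_pdivrMr // => h; rewrite [in leRHS]Npow mulrA mulrA.
  by rewrite ler_wpM2r ?powR_ge0 // [leRHS]mulrC.
have dV v : (2 * deg v <= #|V|)%N.
  rewrite -(ler_nat R) natrM; apply: le_trans (ler_wpM2l _ (dmax v)) _ => //.
  have h : 2 * C <= N `^ (1 - alpha^-1) by apply: n2P; clear -nV; lia.
  by rewrite -/N [leRHS]Npow mulrA ler_wpM2r ?powR_ge0.
have Neta : 16 * C ^+ 2 <= c * N `^ eta.
  have : 16 * C ^+ 2 / c <= N `^ eta by apply: n3P; clear -nV; lia.
  by rewrite ler_pdivrMr // [_ * c]mulrC.
have l1 := log2_ge1 N2.
pose m v := (Num.truncn (3 * log2 N +
  E * ((deg v)%:R * (deg v)%:R `^ (2 - alpha)))).+1.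
have ED0 v : 0 <= E * ((deg v)%:R * (deg v)%:R `^ (2 - alpha)).
  by rewrite mulr_ge0 ?(ltW E0) // mulr_ge0 ?powR_ge0.
have m_ge v := truncnS_gt (3 * log2 N +
  E * ((deg v)%:R * (deg v)%:R `^ (2 - alpha))).
pose small v := crowded (copies_of deg [set v]) (m v)
  (copies_of deg [set w | deg v <= q * deg w]%N).
pose codom_bad v M := (K <= deg v)%N &&
  [exists g : {ffun 'I_(deg v %/ q)%N.+1 -> V},
     crowded (copies_of deg [set v]) (deg v %/ 2)%N
       (copies_of deg [set w in codom g]) M].
have good M v : M \in perfect_matchings (copies deg) -> ~~ small v M ->
    ~~ codom_bad v M ->
    few_high_neighbors (4 + E * q%:R * A + K%:R) (erased_graph M) v.
  move=> Mp sm cb; rewrite /few_high_neighbors -/N.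
  set k := gdeg _ v; set X := _ * _ * \sum_(_ <= _ < _) _; set c2 := _ + K%:R.
  have kD : (k <= deg v)%N by exact: gdeg_erased_le.
  have l_le : log2 N <= Num.max (log2 N) X by rewrite le_max lexx.
  have X_le : X <= Num.max (log2 N) X by rewrite le_max lexx orbT.
  have c2pos : 4 + E * q%:R * A <= c2 /\ K%:R <= c2.
    by rewrite /c2 lerDl lerDr ler0n addr_ge0 // !mulr_ge0 // ltW.
  have [kK|Kk] := ltnP k K.
    apply: le_trans (_ : K%:R <= _).
      rewrite ler_nat (leq_trans _ (ltnW kK)) // subset_leq_card //.
      by apply/subsetP => w; rewrite !inE => /andP[].
    rewrite -[leLHS]mulr1 ler_pM //; first by case: c2pos.
    exact: le_trans l_le.
  have cb' : (K <= deg v)%N -> ~~ [exists g : {ffun 'I_(deg v %/ q)%N.+1 -> V},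
      crowded (copies_of deg [set v]) (deg v %/ 2)%N
        (copies_of deg [set w in codom g]) M].
    by move=> KD; move: cb; rewrite /codom_bad KD.
  have [Dqk cm] := not_crowded_neighbors Mp (isT : 0 < q)%N sm cb' Kk.
  have k0 : (0 < k)%N by apply: leq_trans Kk; rewrite Kdef.
  have kR : 0 < k%:R :> R by rewrite ltr0n.
  (* The factors are compared separately, by D <= q k and by k <= D with 2 - alpha < 0, so the sign
     of 3 - alpha does not matter. *)
  have DX : (deg v)%:R * (deg v)%:R `^ (2 - alpha) <= q%:R * (A * X).
    apply: le_trans (_ : q%:R * (k%:R * k%:R `^ (2 - alpha)) <= _); last first.
      rewrite ler_wpM2l // Adef sum_powR_ge //.
      by apply: leq_trans (dV v); rewrite leq_mul2l.
    rewrite mulrA -natrM ler_pM ?powR_ge0 ?ler_nat //.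
    by apply: le_powR_nonpos; rewrite ?ler_nat //; lra.
  apply: le_trans (_ : (Num.truncn (3 * log2 N +
    E * ((deg v)%:R * (deg v)%:R `^ (2 - alpha))))%:R <= _).
    by rewrite ler_nat -ltnS.
  apply: le_trans (_ : 3 * log2 N +
    E * ((deg v)%:R * (deg v)%:R `^ (2 - alpha)) <= _).
    by rewrite truncn_le addr_ge0 // mulr_ge0 //; lra.
  have EX : E * ((deg v)%:R * (deg v)%:R `^ (2 - alpha)) <= E * q%:R * A * X.
    by rewrite -!mulrA ler_pM2l.
  set Z := Num.max _ _ in l_le X_le *.
  have EZ : E * q%:R * A * X <= E * q%:R * A * Z.
    by rewrite ler_wpM2l // !mulr_ge0 // ltW.
  have Z0 : 0 <= Z by lra.
  apply: le_trans (_ : (4 + E * q%:R * A) * Z <= _).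
    by rewrite mulrDl; lra.
  by rewrite ler_wpM2r //; case: c2pos.
have P0 := ler0n R #|perfect_matchings (copies deg)|.
have bound v : #|[set M in perfect_matchings (copies deg) |
    small v M || codom_bad v M]|%:R * N ^+ 3 <=
    2 * #|perfect_matchings (copies deg)|%:R.
  set P := #|perfect_matchings _|%:R in P0 *.
  apply: le_trans (_ : (#|[set M in perfect_matchings (copies deg) | small v M]|%:R +
     #|[set M in perfect_matchings (copies deg) | codom_bad v M]|%:R) * N ^+ 3 <= _).
    rewrite ler_wpM2r ?exprn_ge0 ?(ltW N0) // -natrD ler_nat.
    apply: leq_trans (leq_card_setU _ _).1; apply/subset_leq_card/subsetP => M.
    by rewrite !inE => /andP[-> /=].
  rewrite mulrDl [leRHS](_ : _ = P + P); last by ring.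
  apply: lerD.
    apply: (card_crowded_poly al2 c0 C0) => //.
    - by apply: le_trans (ltW (m_ge v)); rewrite lerDl.
    - by apply: le_trans (ltW (m_ge v)); rewrite -Edef lerDr; lra.
  rewrite /codom_bad; case: (leqP K (deg v)) => KD; last first.
    rewrite (_ : [set _ in _ | _] = set0) ?cards0 ?mul0r //.
    by apply/setP => M; rewrite !inE andbF.
  apply: (card_crowded_codom_poly al0 c0 C0 N2 LN (dT v) dmax eta0 eal) => //.
    by apply: leq_trans KD; rewrite Kdef leq_addr.
  apply: le_trans (ltW (truncnS_gt _)) _; rewrite ler_nat.
  by apply: leq_trans KD; rewrite Kdef leq_addl.
set P := #|perfect_matchings _|%:R in P0 bound *.
have N20 : 0 < N ^+ 2 by rewrite exprn_gt0.
(* Of the factor N^3, one N is spent on the sum over vertices, one absorbs the factor 2 of [bound],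
   and one remains. *)
rewrite -(ler_pM2r N20) -[leLHS]mulrA -exprS.
apply: le_trans (_ : (\sum_v #|[set M in perfect_matchings (copies deg) |
    small v M || codom_bad v M]|%:R) * N ^+ 3 <= _).
  rewrite ler_wpM2r ?exprn_ge0 ?(ltW N0) // -natr_sum ler_nat.
  apply: leq_trans (card_exists_le _ xpredT (fun v M => small v M || codom_bad v M)).
  apply/subset_leq_card/subsetP => M; rewrite inE => /andP[Mp].
  rewrite negb_forall => /existsP[v vM]; rewrite inE Mp /=.
  apply/existsP; exists v; rewrite /=; apply: contraR vM.
  by rewrite negb_or => /andP[]; exact: good.
rewrite mulr_suml; apply: le_trans (ler_sum _ (fun v _ => bound v)) _.
rewrite sumr_const -[_ *+ #|_|]mulr_natr -/N.
rewrite [leLHS](_ : _ = P * (2 * N)); last by ring.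
by rewrite ler_wpM2l // expr2 ler_wpM2r // ltW.
Qed.

End Neighborhoods.

(** * The erased configuration model: choice of constants and conclusion *)

Theorem theorem3p11 (R : realType) (alpha : R) (halpha : 1 < alpha)
    (a b : R) (ha : 0 < a) (hb : 0 < b) :
  exists c1 c2 c : R, [/\ 0 < c1, 0 < c2 & 0 < c] /\
  exists n0 : nat, forall (n : nat) (deg : 'I_n -> nat),
    (n0 <= n)%N -> power_law_degrees a b alpha deg ->
    (forall M, M \in matchings deg -> PLB c1 alpha 0 (erased_graph M)) /\
    (2 < alpha ->
      1 - (nvert deg)%:R `^ (- c) <=
      erased_prob R (fun G : sgraph 'I_(nvert deg) =>
        PLB_neighborhoods c1 c2 alpha 0 G)).
Proof.
have al0 : 0 < alpha by lra.
pose C1 := 1 + b * (2 `^ alpha / (alpha - 1)).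
have C1gt0 : 0 < C1.
  rewrite /C1 ltr_pwDl // mulr_ge0 ?(ltW hb) // divr_ge0 ?powR_ge0 //; lra.
exists (C1 * 2 `^ alpha).
have C1g : 0 < C1 * 2 `^ alpha by rewrite mulr_gt0 // powR_gt0.
have [al2|al2] := leP alpha 2.
  exists 1, 1; split; first by rewrite C1g ltr01.
  exists 1%N => n deg n1 Hdeg; split=> // M; exact: (PLB_erased n1 hb Hdeg).
have g1 : 1 < alpha - 1 by lra.
pose C2 := 1 + b * (2 `^ (alpha - 1) / (alpha - 1 - 1)).
have C2gt0 : 0 < C2.
  rewrite /C2 ltr_pwDl // mulr_ge0 ?(ltW hb) // divr_ge0 ?powR_ge0 //; lra.
(* A single constant for the degree tail and the maximum degree. *)
pose C := C2 + (1 + b) `^ alpha^-1.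
have b1 : 0 < (1 + b) `^ alpha^-1 by rewrite powR_gt0 //; lra.
have C0 : 0 < C by rewrite addr_gt0.
(* There are at least a n / 2 copies and at most 2 n vertices. *)
have c0 : 0 < a / 4 by rewrite divr_gt0.
have [c2 c20 [n1 Hn1]] := erased_few_high_neighbors al2 c0 C0.
exists c2, 1; split; first by rewrite C1g c20 ltr01.
exists (n1 + (Num.truncn (2 / a)).+1)%N => n deg nn Hdeg.
have n0 : (0 < n)%N by apply: leq_trans nn; rewrite addnS.
have an : 2 <= a * n%:R.
  rewrite mulrC -ler_pdivrMr //; apply/ltW/(lt_le_trans (truncnS_gt _)).
  by rewrite ler_nat (leq_trans _ nn) // leq_addl.
have PLBM M : M \in matchings deg -> PLB (C1 * 2 `^ alpha) alpha 0 (erased_graph M).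
  exact: (PLB_erased n0 hb Hdeg).
split=> // _.
have /andP[nN Nn] := nvert_le2 deg n0.
set N := nvert deg in nN Nn *.
have N0 : 0 < N%:R :> R by rewrite ltr0n (leq_trans n0).
have nNR : n%:R <= N%:R :> R by rewrite ler_nat.
have bad_le := Hn1 _ (@even_deg n deg).
rewrite card_ord -/N in bad_le.
have {}bad_le := bad_le (leq_trans (leq_trans (leq_addr _ _) nn) nN).
rewrite /erased_prob -/N.
set P := perfect_matchings _ in bad_le.
have P0 : 0 < #|P|%:R :> R by rewrite ltr0n perfect_matchings_gt0 // even_card_copies.
set bad := [set M in P | _] in bad_le.
rewrite matchingsE -/P ler_pdivlMr //.
have {}bad_le : #|bad|%:R * N%:R <= #|P|%:R :> R.
  apply: bad_le => [|v|k k0].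
  - apply: le_trans (card_copies_ge Hdeg an).
    have : N%:R <= 2 * n%:R :> R by rewrite -natrM ler_nat.
    by move=> h; rewrite (le_trans (ler_wpM2l (ltW c0) h)) //; lra.
  - apply: le_trans (even_deg_le n0 hb Hdeg v al0) _.
    rewrite powRM //; last by lra.
    apply: ler_pM; rewrite ?powR_ge0 ?lerDr ?(ltW C2gt0) //.
    by apply: ge0_ler_powR; rewrite ?nnegrE ?invr_ge0 ?(ltW al0).
  - have := @even_deg_moment R a b alpha n deg n0 hb Hdeg 1 k.
    move=> /(_ g1 k0)/le_trans; apply.
    rewrite (_ : 1 - (alpha - 1) = 2 - alpha); last by ring.
    rewrite ler_wpM2r ?powR_ge0 // -/C2 ler_pM ?(ltW C2gt0) //.
    by rewrite /C lerDl ltW.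
have card_le : (#|P| <= #|bad| + #|[set M in P |
    `[< PLB_neighborhoods (C1 * 2 `^ alpha) c2 alpha 0 (erased_graph M) >]]|)%N.
  apply: leq_trans (leq_card_setU _ _).1; apply/subset_leq_card/subsetP => M MP.
  rewrite in_setU in_set MP /= [M \in [set _ in _ | _]]in_set MP /=.
  case: forallP => //= few; apply/asboolP; split.
    by apply: PLBM; rewrite matchingsE.
  by move=> v; exact: few.
rewrite powR_inv1 ?ler0n // mulrBl mul1r lerBlDr.
move: card_le; rewrite -(ler_nat R) natrD => /le_trans; apply.
by rewrite addrC lerD2l mulrC ler_pdivlMr.
Qed.
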